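(* In the multi-unit auction with unit demand (with $m$ units, $n$ bidders, $1\le m\le n-1$, types in $[L,U]$), no feasible Groves mechanism welfare dominates an OEL mechanism (of any index $k$).
   Context: Multi-unit auction with unit demand: $m$ identical units, $n\ge 2$ bidders, $1\le m\le n-1$, each bidder wants at most one unit; bidder $i$'s type $\theta_i\in\Theta_i=[L,U]$ ($L<U$) is her value for one unit, and $v_i=\theta_i$ if she gets a unit, $0$ otherwise. Efficient decisions allocate units to $m$ highest bidders. A Groves mechanism (efficient decision function $f$) has taxes $t_i(\theta)=\sum_{j\ne i}v_j(f(\theta),\theta_j)+h_i(\theta_{-i})$; player $i$'s utility is value plus $t_i$. The VCG (Clarke) mechanism uses $h_i(\theta_{-i})=-\max_d\sum_{j\ne i}v_j(d,\theta_j)$; here $\sum_i t_i^{VCG}(\theta)=-m[\theta]_{m+1}$, where $[x]_j$ denotes the $j$th highest entry of a vector $x$. A mechanism is feasible if $\sum_i t_i(\theta)\le 0$ for all $\theta$. Mechanism $t'$ welfare dominates $t$ (same decision function) if $\sum_i t_i(\theta)\le\sum_i t'_i(\theta)$ for all $\theta$ with strict inequality for some $\theta$. OEL mechanisms: $t_i(\theta)=t_i^{VCG}(\theta)+c_0+\sum_{j=1}^{n-1}c_j[\theta_{-i}]_j$, where for an index $k\in\{0,\dots,n\}$ with $k-m$ odd the constants are: writing $\alpha_i=(-1)^{m-i}\binom{n-i-1}{n-m-1}/\binom{m-1}{i-1}$ and $\beta_i=(-1)^{m-i-1}\binom{i-1}{m-1}/\binom{n-m-1}{n-i-1}$, • $k=0$: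 $c_i=\alpha_i$ for $i=1,\dots,m$; $c_0=Um/n-U\sum_{i=1}^m\alpha_i$; other $c_i=0$. • $1\le k\le m$: $c_i=\alpha_i$ for $i=k+1,\dots,m$; $c_k=m/n-\sum_{i=k+1}^m\alpha_i$; other $c_i=0$ (including $c_0$). • $m+1\le k\le n-1$: $c_i=\beta_i$ for $i=m+1,\dots,k-1$; $c_k=m/n-\sum_{i=m+1}^{k-1}\beta_i$; other $c_i=0$. • $k=n$: $c_i=\beta_i$ for $i=m+1,\dots,n-1$; $c_0=Lm/n-L\sum_{i=m+1}^{n-1}\beta_i$; other $c_i=0$. *)

(* Defs.v *)
From HB Require Import structures.
From mathcomp Require Import all_boot all_order all_algebra.
Set Implicit Arguments. Unset Strict Implicit. Unset Printing Implicit Defensive.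
Import Order.TTheory GRing.Theory Num.Theory.
Local Open Scope ring_scope.

Section Auction.
Variable R : realFieldType.

Definition kth (s : seq R) (j : nat) : R :=
  nth 0 (sort (fun a b => b <= a) s) j.-1.

Definition others (n : nat) (theta : 'I_n -> R) (i : 'I_n) : seq R :=
  [seq theta j | j <- enum 'I_n & j != i].

Definition profile (n : nat) (theta : 'I_n -> R) : seq R :=
  [seq theta j | j <- enum 'I_n].

Definition in_dom (n : nat) (L U : R) (theta : 'I_n -> R) : Prop :=
  forall i, L <= theta i <= U.

(* A decision is the set of bidders receiving a unit.
   v_i(d, theta_i) = theta_i if i gets a unit, 0 otherwise. *)
Definition value (n : nat) (theta : 'I_n -> R) (d : {set 'I_n}) (i : 'I_n) : R :=
  if i \in d then theta i else 0.

Definition efficient (n m : nat) (L U : R) (f : ('I_n -> R) -> {set 'I_n}) : Prop :=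
  forall theta, in_dom L U theta ->
    #|f theta| = m /\
    (forall i j, i \in f theta -> j \notin f theta -> theta j <= theta i).

(* Mechanisms: t i theta = tax (transfer) of player i at profile theta. *)
Definition mechanism (n : nat) := 'I_n -> ('I_n -> R) -> R.

Definition groves (n : nat) (L U : R) (f : ('I_n -> R) -> {set 'I_n})
    (t : mechanism n) : Prop :=
  exists h : 'I_n -> ('I_n -> R) -> R,
    (forall i theta theta', in_dom L U theta -> in_dom L U theta' ->
        (forall j, j != i -> theta j = theta' j) -> h i theta = h i theta') /\
    (forall theta, in_dom L U theta -> forall i,
        t i theta = \sum_(j | j != i) value theta (f theta) j + h i theta).

Definition feasible (n : nat) (L U : R) (t : mechanism n) : Prop :=
  forall theta, in_dom L U theta -> \sum_i t i theta <= 0.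

Definition welfare_dominates (n : nat) (L U : R) (t' t : mechanism n) : Prop :=
  (forall theta, in_dom L U theta -> \sum_i t i theta <= \sum_i t' i theta) /\
  (exists theta, in_dom L U theta /\ \sum_i t i theta < \sum_i t' i theta).

(* VCG (Clarke) mechanism: h_i(theta_{-i}) = - max_d sum_{j<>i} v_j(d,theta_j),
   the max over allocations of the m units among the bidders other than i,
   i.e. minus the sum of the m highest entries of theta_{-i}. *)
Definition vcg (n m : nat) (f : ('I_n -> R) -> {set 'I_n}) : mechanism n :=
  fun i theta =>
    \sum_(j | j != i) value theta (f theta) j
    - \sum_(1 <= j < m.+1) kth (others theta i) j.

Definition alpha (n m i : nat) : R :=
  (-1) ^+ (m - i) * ('C(n - i - 1, n - m - 1))%:R / ('C(m - 1, i - 1))%:R.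

(* (-1)^(m-i-1) = (-1)^(i-m-1) for i >= m+1 *)
Definition beta (n m i : nat) : R :=
  (-1) ^+ (i - m - 1) * ('C(i - 1, m - 1))%:R / ('C(n - m - 1, n - i - 1))%:R.

Definition oel_c (n m : nat) (L U : R) (k j : nat) : R :=
  let mn := m%:R / n%:R in
  if k == 0%N then
    (if j == 0%N then U * mn - U * \sum_(1 <= i < m.+1) alpha n m i
     else if (j <= m)%N then alpha n m j else 0)
  else if (k <= m)%N then
    (if j == k then mn - \sum_(k.+1 <= i < m.+1) alpha n m i
     else if (k < j <= m)%N then alpha n m j else 0)
  else if (k <= n - 1)%N then
    (if j == k then mn - \sum_(m.+1 <= i < k) beta n m i
     else if (m < j < k)%N then beta n m j else 0)
  else
    (if j == 0%N then L * mn - L * \sum_(m.+1 <= i < n) beta n m i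
     else if (m < j < n)%N then beta n m j else 0).

Definition oel (n m : nat) (L U : R) (f : ('I_n -> R) -> {set 'I_n}) (k : nat)
    : mechanism n :=
  fun i theta =>
    vcg m f i theta + oel_c n m L U k 0
    + \sum_(1 <= j < n) oel_c n m L U k j * kth (others theta i) j.

End Auction.

(* Main.v *)
(** The difference of two Groves taxes is a sum D(theta) = sum_i g_i(theta_-i), and
    here D >= 0. Call theta pivotal if [theta]_k = [theta]_(k+1), where
    [theta]_0 = U and [theta]_(n+1) = L; the OEL constants make the budget
    telescope to a multiple of [theta]_k - [theta]_(k+1), so feasibility forces
    D <= 0 on pivotal profiles. Averaging over permutations of the bidders makes
    g symmetric. Replacing the entries of a pivotal profile one by one by the
    common value v of [theta]_k and [theta]_(k+1) keeps it pivotal, and induction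
    on the number of entries different from v gives g = 0 at pivotal profiles,
    hence everywhere, since every theta_-i extends to a pivotal profile. So the
    average of D over permutations is 0, and D = 0 because D >= 0. *)

Require Import Defs.
From HB Require Import structures.
From mathcomp Require Import all_boot all_order all_algebra.
From mathcomp Require Import fingroup perm ring zify.
Import Order.TTheory GRing.Theory Num.Theory.
Local Open Scope ring_scope.

(** * Symmetrization, and vanishing deduced from pivotal profiles *)

Section Pivot.
Set Implicit Arguments.
Unset Strict Implicit.
Context {R : realFieldType} {n : nat} (L U : R) (k : nat).
Implicit Types (theta : 'I_n -> R) (a b i : 'I_n) (v : R).

(* With the conventions [theta]_0 = U and [theta]_(n+1) = L, this says that
   [theta]_k = [theta]_(k+1) = v; truncated subtraction covers k = 0 and k = n. *)
Definition pivot theta v : Prop :=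
  [/\ (#|[set i | (v < theta i)%R]| <= k.-1)%N,
      (#|[set i | (theta i < v)%R]| <= (n - k).-1)%N,
      k = 0%N -> v = U & k = n -> v = L].

Definition upd theta a v : 'I_n -> R := fun i => if i == a then v else theta i.

Lemma updE theta a v i : i != a -> upd theta a v i = theta i.
Proof. by rewrite /upd => /negPf->. Qed.

Lemma in_dom_upd theta a v :
  in_dom L U theta -> L <= v <= U -> in_dom L U (upd theta a v).
Proof. by move=> dth dv i; rewrite /upd; case: ifP. Qed.

Lemma pivot_upd theta a v : pivot theta v -> pivot (upd theta a v) v.
Proof.
case=> gtv ltv k0 kn; split => //.
- apply: leq_trans gtv; apply/subset_leq_card/subsetP => i; rewrite !inE /upd.
  by case: ifP => //; rewrite ltxx.
- apply: leq_trans ltv; apply/subset_leq_card/subsetP => i; rewrite !inE /upd.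
  by case: ifP => //; rewrite ltxx.
Qed.

(** The two counts in [pivot] add up to at most [n - 1], also when a truncated subtraction occurs at
    [k = 0] or [k = n], so some entry is neither above nor below [v]. *)
Lemma pivot_hit theta v :
  (0 < n)%N -> (k <= n)%N -> pivot theta v -> exists a, theta a = v.
Proof.
move=> n0 kn [gtv ltv _ _]; case: (pickP [pred i | theta i == v]) => [a /eqP|nov].
  by exists a.
have := cardsC [set i | v < theta i].
have -> : ~: [set i | v < theta i] = [set i | theta i < v].
  apply/setP => i; rewrite !inE -leNgt le_eqVlt.
  by have /= -> := nov i.
by rewrite card_ord; lia.
Qed.

Context (g : 'I_n -> ('I_n -> R) -> R).
Hypothesis n_gt0 : (0 < n)%N.
Hypothesis k_le_n : (k <= n)%N.
Hypothesis g_local : forall i theta theta', in_dom L U theta -> in_dom L U theta' ->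
  (forall j, j != i -> theta j = theta' j) -> g i theta = g i theta'.

(** An average over relabellings, up to the factor n!. Position [s^-1 a] of [theta \o s] holds
    [theta a], so each summand ignores the entry of bidder [a]. *)
Definition symmetrized a theta : R :=
  \sum_(s : {perm 'I_n}) g (s^-1%g a) (theta \o s).

Lemma in_dom_perm theta (s : {perm 'I_n}) :
  in_dom L U theta -> in_dom L U (theta \o s).
Proof. by move=> dth i; apply: dth. Qed.

Lemma symmetrized_local a theta theta' : in_dom L U theta -> in_dom L U theta' ->
  (forall j, j != a -> theta j = theta' j) ->
  symmetrized a theta = symmetrized a theta'.
Proof.
move=> dth dth' eqth; apply: eq_bigr => s _.
apply: g_local => [||j ja]; try exact: in_dom_perm.
by apply: eqth; apply: contraNneq ja => <-; rewrite permK.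
Qed.

(** Composing each relabelling with the transposition of [a] and [b] exchanges the two sums, and the
    transposition fixes [theta] when the two entries agree. *)
Lemma symmetrized_eq a b theta : in_dom L U theta -> theta a = theta b ->
  symmetrized a theta = symmetrized b theta.
Proof.
move=> dth eqab; rewrite /symmetrized.
rewrite [RHS](reindex_inj (mulIg (tperm a b))) /=; apply: eq_bigr => s _.
rewrite invMg permM tpermV tpermR.
apply: g_local => [||j _]; try exact: in_dom_perm.
by rewrite /= permM; case: tpermP => [->|->|].
Qed.

Lemma sum_symmetrized theta :
  \sum_a symmetrized a theta = \sum_(s : {perm 'I_n}) \sum_i g i (theta \o s).
Proof.
rewrite exchange_big; apply: eq_bigr => s _.
by rewrite (reindex_inj (@perm_inj _ s)) /=; apply: eq_bigr => i _; rewrite permK.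
Qed.

Hypothesis g_ge0 : forall theta, in_dom L U theta -> 0 <= \sum_i g i theta.
Hypothesis g_pivot :
  forall theta v, in_dom L U theta -> pivot theta v -> \sum_i g i theta <= 0.

Lemma pivot_perm theta v (s : {perm 'I_n}) : pivot theta v -> pivot (theta \o s) v.
Proof.
have card_perm (P : pred R) : #|[set i | P ((theta \o s) i)]| = #|[set i | P (theta i)]|.
  rewrite -[RHS](card_preimset _ (@perm_inj _ s)).
  by apply: eq_card => i; rewrite !inE.
by case=> gtv ltv k0 kn; split => //; rewrite (card_perm (> v), card_perm (< v)).
Qed.

(** A bidder off [v] may have her entry moved to [v] without changing her term, which is then 0 by
    induction. The bidders at [v] have equal terms with total 0, and [pivot_hit] provides at least
    one such bidder, so the common term is 0. *)
Lemma symmetrized_pivot a theta v :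
  in_dom L U theta -> pivot theta v -> symmetrized a theta = 0.
Proof.
have [N] := ubnP #|[set i | theta i != v]|.
elim: N => // N IHN in theta a * => leN dth pth.
have [z thz] := pivot_hit n_gt0 k_le_n pth.
have dv : L <= v <= U by rewrite -thz.
have off b : theta b != v -> symmetrized b theta = 0.
  move=> thb; rewrite (@symmetrized_local b theta (upd theta b v)) //.
  - apply: IHN; last exact: pivot_upd.
    + rewrite -ltnS; apply: leq_trans leN; rewrite ltnS.
      apply/proper_card/properP; split.
        by apply/subsetP => i; rewrite !inE /upd; case: ifP; rewrite ?eqxx.
      by exists b; rewrite !inE // /upd !eqxx.
    + exact: in_dom_upd.
  - exact: in_dom_upd.
  - by move=> j jb; rewrite updE.
have on b : theta b = v -> symmetrized b theta = symmetrized z theta.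
  by move=> thb; apply: symmetrized_eq; rewrite ?thb.
have sum_z : \sum_b symmetrized b theta
           = symmetrized z theta *+ #|[set b | theta b == v]|.
  rewrite (bigID [pred b | theta b == v]) /= [X in _ + X]big1 // addr0.
  rewrite (eq_bigr (fun=> symmetrized z theta)) => [|b /eqP /on //].
  by rewrite sumr_const cardsE.
have sum0 : \sum_b symmetrized b theta = 0.
  (* Relabelled profiles are again pivotal, so every inner sum is both nonnegative and
     nonpositive. *)
  rewrite sum_symmetrized big1 // => s _; apply/eqP.
  rewrite eq_le g_ge0 ?(g_pivot (v := v)) //; try exact: in_dom_perm.
  exact: pivot_perm.
have z0 : symmetrized z theta = 0.
  apply/eqP; move/eqP: sum0; rewrite sum_z mulrn_eq0 cards_eq0.
  by case/orP => // /eqP /setP /(_ z); rewrite !inE thz eqxx.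
by have [/on ->|/off] := eqVneq (theta a) v.
Qed.

Hypothesis pivot_exists : forall theta a, in_dom L U theta ->
  exists2 v, L <= v <= U & pivot (upd theta a v) v.

Lemma pivot_sum_eq0 theta : in_dom L U theta -> \sum_i g i theta = 0.
Proof.
move=> dth.
have sym0 a : symmetrized a theta = 0.
  have [v dv pv] := pivot_exists a dth.
  rewrite (@symmetrized_local a theta (upd theta a v)) //.
  - by apply: symmetrized_pivot pv; apply: in_dom_upd.
  - exact: in_dom_upd.
  - by move=> j ja; rewrite updE.
have : \sum_(s : {perm 'I_n}) \sum_i g i (theta \o s) = 0.
  by rewrite -sum_symmetrized big1.
(* A vanishing sum of nonnegative terms has only zero terms; the identity permutation gives the term
   wanted. *)
move/psumr_eq0P => sum0; have {sum0} : \sum_i g i (theta \o (1%g : {perm _})) = 0.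
  by apply: sum0 => // s _; apply: g_ge0; apply: in_dom_perm.
apply: etrans; apply: eq_bigr => i _.
apply: g_local => // [|j _]; first exact: in_dom_perm.
by rewrite /= perm1.
Qed.

End Pivot.

(** * Order statistics of a profile and of the profile without one bidder *)

Section OrderStatistics.
Set Implicit Arguments.
Unset Strict Implicit.
Context {R : realFieldType}.
Implicit Types (s : seq R) (x v : R).

Local Notation geR := (fun a b : R => b <= a).

Let geR_total : total geR. Proof. by move=> x y; apply: le_total. Qed.
Let geR_trans : transitive geR. Proof. by move=> y x z yx zy; apply: le_trans yx. Qed.
Let geR_anti : antisymmetric geR.
Proof. by move=> x y; rewrite andbC; apply: le_anti. Qed.

Lemma nth_sorted_ge s i j :
  sorted geR s -> (i <= j)%N -> (j < size s)%N -> nth 0 s j <= nth 0 s i.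
Proof.
move=> ss ij js.
by apply: (sorted_leq_nth geR_trans _ 0 ss) => //; rewrite ?inE ?(leq_ltn_trans ij).
Qed.

Lemma count_gt_nth s p : sorted geR s -> (count (> nth 0 s p)%R s <= p)%N.
Proof.
move=> ss; have [sp|ps] := leqP (size s) p.
  exact: leq_trans (count_size _ _) sp.
set v := nth 0 s p; rewrite -[in X in (X <= _)%N](cat_take_drop p s) count_cat.
rewrite [X in (_ + X)%N](_ : _ = 0%N) ?addn0.
  by apply: leq_trans (count_size _ _) _; rewrite size_take ps.
apply/eqP; rewrite -leqn0 leqNgt -has_count -all_predC; apply/(all_nthP 0) => i.
by rewrite size_drop => ip /=; rewrite nth_drop -leNgt nth_sorted_ge ?leq_addr -?ltn_subRL.
Qed.

Lemma count_lt_nth s p :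
  sorted geR s -> (p < size s)%N -> (count (< nth 0 s p)%R s < size s - p)%N.
Proof.
move=> ss ps.
set v := nth 0 s p; rewrite -[in X in (X < _)%N](cat_take_drop p.+1 s) count_cat.
rewrite [X in (X + _)%N](_ : _ = 0%N) ?add0n.
  by apply: leq_ltn_trans (count_size _ _) _; rewrite size_drop ltn_sub2l.
apply/eqP; rewrite -leqn0 leqNgt -has_count -all_predC; apply/(all_nthP 0) => i.
rewrite size_takel // => ip /=.
by rewrite nth_take // -leNgt nth_sorted_ge.
Qed.

(** Were the entry at [p] above [v], the first [p + 1] entries would all exceed [v]; were it below,
    all entries from [p] on would be below [v]. *)
Lemma nth_sorted_eq s p v : sorted geR s -> (p < size s)%N ->
  (count (> v)%R s <= p)%N -> (count (< v)%R s < size s - p)%N -> nth 0 s p = v.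
Proof.
move=> ss ps gtv ltv; apply/eqP; rewrite eq_le !leNgt; apply/andP; split.
- apply/negP => vp; move: gtv; apply/negP; rewrite -ltnNge.
  rewrite -(cat_take_drop p.+1 s) count_cat ltn_addr //.
  have -> : count (> v) (take p.+1 s) = size (take p.+1 s).
    apply/eqP; rewrite -all_count; apply/(all_nthP 0) => i.
    rewrite size_takel // => ip; rewrite nth_take //=.
    by apply: lt_le_trans vp _; rewrite nth_sorted_ge.
  by rewrite size_takel.
- apply/negP => vp; move: ltv; apply/negP; rewrite -leqNgt.
  rewrite -[X in (_ <= count _ X)%N](cat_take_drop p s) count_cat.
  have -> : count (< v) (drop p s) = size (drop p s).
    apply/eqP; rewrite -all_count; apply/(all_nthP 0) => i.
    rewrite size_drop => ip; rewrite nth_drop /=.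
    by apply: le_lt_trans vp; rewrite nth_sorted_ge ?leq_addr -?ltn_subRL.
  by rewrite size_drop leq_addl.
Qed.

Lemma nth_rem_sorted s x j : sorted geR s -> x \in s -> (j < size s)%N ->
  nth 0 (rem x s) j = if x < nth 0 s j then nth 0 s j else nth 0 s j.+1.
Proof.
move=> ss xs js; have ps : (index x s < size s)%N by rewrite index_mem.
rewrite remE nth_cat size_take ps; case: ltnP => [jp|pj].
  rewrite nth_take // lt_neqAle -[X in X <= _](nth_index 0 xs).
  (* Strictness holds because [index] finds the first occurrence: no earlier entry equals [x]. *)
  rewrite nth_sorted_ge ?(ltnW jp) // andbT eq_sym.
  by rewrite -[_ == x]/(pred1 x _) before_find.
rewrite nth_drop addSn subnKC //.
by rewrite -[X in X < _](nth_index 0 xs) ltNge nth_sorted_ge.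
Qed.

Context {n : nat}.
Implicit Types (theta : 'I_n -> R).

Lemma size_profile theta : size (profile theta) = n.
Proof. by rewrite size_map size_enum_ord. Qed.

Lemma count_profile theta (P : pred R) :
  count P (sort geR (profile theta)) = #|[set i | P (theta i)]|.
Proof.
rewrite (seq.permP (permEl (perm_sort _ _))) count_map cardE -size_filter.
by rewrite enumT; congr size; apply: eq_filter => i; rewrite !inE.
Qed.

Lemma perm_profile_others theta i :
  perm_eq (profile theta) (theta i :: others theta i).
Proof.
rewrite /profile /others -map_cons; apply: perm_map.
by rewrite -rem_filter ?enum_uniq //; apply: perm_to_rem; rewrite mem_enum.
Qed.

Lemma size_others theta i : size (others theta i) = n.-1.
Proof.
rewrite -[LHS]/((size (theta i :: others theta i)).-1).
by rewrite -(perm_size (perm_profile_others _ _)) size_profile.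
Qed.

Lemma sort_others theta i :
  sort geR (others theta i) = rem (theta i) (sort geR (profile theta)).
Proof.
have thi : theta i \in sort geR (profile theta).
  by rewrite mem_sort map_f ?mem_enum.
apply: (sorted_eq geR_trans geR_anti); first exact: sort_sorted.
  exact: subseq_sorted geR_trans _ _ (rem_subseq _ _) (sort_sorted geR_total _).
rewrite perm_sort -(perm_cons (theta i)) -(permPl (perm_profile_others theta i)).
by rewrite -(permPr (perm_to_rem thi)) perm_sym perm_sort.
Qed.

(** Removing one of the [j] highest entries moves [theta]_(j+1) up to rank [j]; removing any of the
    other [n - j] leaves [theta]_j there. *)
Lemma sum_kth_others theta j : (0 < j < n)%N ->
  \sum_i kth (others theta i) j =
  (n - j)%:R * kth (profile theta) j + j%:R * kth (profile theta) j.+1.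
Proof.
case: j => // j /= jn; rewrite /kth /=; set s := sort geR (profile theta).
have ss : sorted geR s by apply: sort_sorted.
have sz : size s = n by rewrite size_sort size_profile.
pose F x := if x < nth 0 s j then nth 0 s j else nth 0 s j.+1.
transitivity (\sum_(x <- s) F x).
  rewrite (perm_big (profile theta)) /=; last by rewrite perm_sort.
  rewrite big_map enumT; apply: eq_bigr => i _.
  by rewrite sort_others nth_rem_sorted ?sz ?(ltnW jn) // mem_sort map_f ?mem_enum.
rewrite (big_nth 0) sz (@big_cat_nat _ _ _ j.+1) //=; last exact: ltnW.
rewrite addrC !big_nat.
rewrite (eq_bigr (fun=> nth 0 s j)) => [|p /andP[jp pn]]; last first.
  (* In case of a tie with position [j], the entries at [j] and [j.+1] coincide, so either branch of
     [F] gives the same value. *)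
  rewrite /F; case: ltP => // sjp; apply: le_anti.
  by rewrite nth_sorted_ge ?sz //= (le_trans sjp) // nth_sorted_ge ?sz.
rewrite [X in _ + X](eq_bigr (fun=> nth 0 s j.+1)) => [|p pj]; last first.
  by rewrite /F ltNge nth_sorted_ge ?sz //; apply: ltnW.
by rewrite -!big_nat !sumr_const_nat subn0 !mulr_natl.
Qed.

(** Winners have values at least those of losers, so the sorted profile is the sorted list of
    winners followed by that of losers. *)
Lemma sum_value_top theta (d : {set 'I_n}) :
  (forall i j, i \in d -> j \notin d -> theta j <= theta i) ->
  \sum_i value theta d i = \sum_(1 <= l < #|d|.+1) kth (profile theta) l.
Proof.
move=> topd.
pose A := [seq theta i | i <- enum 'I_n & i \in d].
pose B := [seq theta i | i <- enum 'I_n & i \notin d].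
have sAB : sort geR (profile theta) = sort geR A ++ sort geR B.
  apply: (sorted_eq geR_trans geR_anti); first exact: sort_sorted.
    rewrite (sorted_pairwise geR_trans) pairwise_cat -!(sorted_pairwise geR_trans).
    rewrite !sort_sorted // !andbT; apply/allrelP => x y.
    rewrite !mem_sort => /mapP[i + ->] /mapP[j + ->].
    by rewrite !mem_filter => /andP[di _] /andP[dj _]; apply: topd.
  rewrite perm_sort perm_sym.
  apply: (@perm_trans _ (A ++ B)); first by apply: perm_cat; rewrite perm_sort.
  rewrite -map_cat; apply: perm_map; apply: permEl; exact: perm_filterC.
have sA : size (sort geR A) = #|d|.
  by rewrite size_sort size_map cardE enumT.
rewrite big_add1 /= /kth sAB -sA big_nat.
rewrite (eq_bigr (fun l => nth 0 (sort geR A) l)) => [|l /= lA]; last first.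
  by rewrite nth_cat lA.
rewrite -big_nat -(big_nth 0 xpredT id) (perm_big A) /=; last by rewrite perm_sort.
rewrite big_map big_filter big_enum_cond /=.
by rewrite [RHS]big_mkcond; apply: eq_bigr.
Qed.

Lemma card_upd theta a v (P : pred R) : ~~ P v ->
  #|[set i | P (upd theta a v i)]| = count P (others theta a).
Proof.
move=> /negPf Pv; rewrite -count_profile (seq.permP (permEl (perm_sort _ _))).
rewrite (seq.permP (perm_profile_others _ a)) /= {1}/upd eqxx Pv add0n.
congr count; apply/eq_in_map => i; rewrite mem_filter => /andP[ia _].
exact: updE.
Qed.

Lemma upd_pivot L U k theta a : (k <= n)%N -> L < U -> in_dom L U theta ->
  exists2 v, L <= v <= U & pivot L U k (upd theta a v) v.
Proof.
move=> kn LU dth; have n0 : (0 < n)%N by apply: leq_ltn_trans (ltn_ord a).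
have oth x : x \in others theta a -> L <= x <= U by case/mapP => i _ ->.
have le_size P : (count P (others theta a) <= n.-1)%N.
  by rewrite (leq_trans (count_size _ _)) ?size_others.
have gtE v : #|[set i | v < upd theta a v i]| = count (> v) (others theta a).
  by apply: (card_upd _ _ (P := > v)); rewrite /= ltxx.
have ltE v : #|[set i | upd theta a v i < v]| = count (< v) (others theta a).
  by apply: (card_upd _ _ (P := < v)); rewrite /= ltxx.
have [k0|k0] := posnP k.
  exists U; first by rewrite lexx ltW.
  split=> [|||keqn]; rewrite ?gtE ?ltE ?k0 ?subn0 //; last by lia.
  rewrite leqn0 -[_ == _]negbK -lt0n -has_count -all_predC; apply/allP => x /oth /andP[_].
  by rewrite /= -leNgt.
have [eqkn|kltn] := eqVneq k n.
  exists L; first by rewrite lexx ltW.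
  split=> [|||]; rewrite ?gtE ?ltE ?eqkn ?subnn //; last by move=> n0'; lia.
  rewrite leqn0 -[_ == _]negbK -lt0n -has_count -all_predC; apply/allP => x /oth /andP[+ _].
  by rewrite /= -leNgt.
have sz : size (sort geR (others theta a)) = n.-1 by rewrite size_sort size_others.
have sso : sorted geR (sort geR (others theta a)) by apply: sort_sorted.
(* Inserting a second copy of the [k]-th highest of the other entries makes ranks [k] and [k + 1]
   equal. *)
exists (kth (others theta a) k).
  by apply: oth; rewrite -(mem_sort geR) mem_nth // sz; lia.
have cnt P : count P (others theta a) = count P (sort geR (others theta a)).
  by rewrite (seq.permP (permEl (perm_sort _ _))).
split; rewrite ?gtE ?ltE ?cnt //; try lia.
- exact: count_gt_nth.
- have kp : (k.-1 < n.-1)%N by lia.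
  have := @count_lt_nth _ k.-1 sso; rewrite sz => /(_ kp) lt_cnt.
  by rewrite -ltnS; apply: leq_trans lt_cnt _; lia.
Qed.

Lemma pivot_kth L U k theta v : pivot L U k theta v -> (k <= n)%N ->
  ((0 < k)%N -> kth (profile theta) k = v) /\
  ((k < n)%N -> kth (profile theta) k.+1 = v).
Proof.
case; have <- := count_profile theta (> v); have <- := count_profile theta (< v).
move=> gtv ltv _ _ kn.
have ss : sorted geR (sort geR (profile theta)) by apply: sort_sorted.
have sz : size (sort geR (profile theta)) = n by rewrite size_sort size_profile.
split=> k0; apply: nth_sorted_eq => //=; rewrite ?sz //; try lia.
all: by apply: leq_ltn_trans ltv _; lia.
Qed.

End OrderStatistics.

(** * Recurrences for the OEL constants and the telescoping budget *)

Section Budget.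
Set Implicit Arguments.
Unset Strict Implicit.
Context {R : realFieldType}.
Implicit Types (n m k l : nat) (x c : nat -> R) (L U v : R).

(* By [sum_kth_others], the total paid when every bidder i receives the j-th
   order statistic of theta_-i, with [x l] in place of [theta]_l. *)
Definition paid n x j : R := (n - j)%:R * x j + j%:R * x j.+1.

Lemma paid1 n j : (j <= n)%N -> paid n (fun=> 1) j = n%:R.
Proof. by move=> jn; rewrite /paid !mulr1 -natrD subnK. Qed.

(** The algebra common to [alpha_rec] and [beta_rec]: [a] and [b] are numerators, [p] and [q]
    denominators, [t] a sign, and [d] a factor shared by two binomial identities, which cancels. *)
Lemma ratio_step (a b p q d l N t : R) : p != 0 -> q != 0 ->
  l * a = d * b -> N * p = d * q ->
  l * (t * a / p) = - (N * (-1 * t * b / q)).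
Proof.
move=> p0 q0 lab Npq.
rewrite (_ : l * (t * a / p) = t * (l * a) / p); last by ring.
rewrite (_ : N * (-1 * t * b / q) = - (t * b * (N * p) / p / q)); last by field; apply/andP.
by rewrite lab Npq; field; apply/andP.
Qed.

Lemma binR_neq0 k l : (l <= k)%N -> 'C(k, l)%:R != 0 :> R.
Proof. by move=> lk; rewrite pnatr_eq0 -lt0n bin_gt0. Qed.

(** The coefficient of [x l.+1] in the sum of [c l * paid n x l] is [l * c l + (n - l.+1) * c l.+1];
    the recurrence says that it vanishes for [alpha]. *)
Lemma alpha_rec n m l : (m < n)%N -> (0 < l < m)%N ->
  l%:R * alpha R n m l = - ((n - l.+1)%:R * alpha R n m l.+1).
Proof.
move=> mn /andP[]; case: l => // l _ lm.
(* Writing [m] and [n] as sums removes the truncated subtractions from the binomials. *)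
have [d dm] : exists d, m = (l + d).+2 by exists (m - l.+2)%N; lia.
subst m; have [r rn] : exists r, n = (l + d + r).+3.
  by exists (n - (l + d).+3)%N; lia.
subst n; rewrite /alpha.
rewrite (_ : (l + d).+2 - l.+1 = d.+1)%N; last lia.
rewrite (_ : (l + d + r).+3 - l.+1 - 1 = (d + r).+1)%N; last lia.
rewrite (_ : (l + d + r).+3 - (l + d).+2 - 1 = r)%N; last lia.
rewrite (_ : (l + d).+2 - 1 = (l + d).+1)%N; last lia.
rewrite (_ : l.+1 - 1 = l)%N; last lia.
rewrite (_ : (l + d + r).+3 - l.+2 = (d + r).+1)%N; last lia.
rewrite (_ : (l + d).+2 - l.+2 = d)%N; last lia.
(* For [alpha] the extra sign belongs to the smaller index, so the equation is turned round to fit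
   [ratio_step]. *)
rewrite !subn1 /= exprS; apply/eqP; rewrite -eqr_oppLR eq_sym; apply/eqP.
apply: (@ratio_step _ _ _ _ d.+1%:R); try by apply: binR_neq0; lia.
- by rewrite -!natrM mul_bin_down subSn ?leq_addl // addnK.
- by rewrite -!natrM mul_bin_left subSn ?leq_addr // addKn.
Qed.

Lemma alphamm n m : alpha R n m m = 1.
Proof. by rewrite /alpha subnn !binn expr0 mul1r divr1. Qed.

Lemma beta_rec n m l : (0 < m)%N -> (m < l)%N -> (l.+1 < n)%N ->
  l%:R * beta R n m l = - ((n - l.+1)%:R * beta R n m l.+1).
Proof.
case: m => // p _ pl ln.
have [d dl] : exists d, l = (p + d).+2 by exists (l - p.+2)%N; lia.
subst l; have [q qn] : exists q, n = (p + d + q).+4.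
  by exists (n - (p + d).+4)%N; lia.
subst n; rewrite /beta.
rewrite (_ : (p + d).+2 - p.+1 - 1 = d)%N; last lia.
rewrite (_ : (p + d).+3 - p.+1 - 1 = d.+1)%N; last lia.
rewrite (_ : (p + d).+2 - 1 = (p + d).+1)%N; last lia.
rewrite (_ : (p + d).+3 - 1 = (p + d).+2)%N; last lia.
rewrite (_ : p.+1 - 1 = p)%N; last lia.
rewrite (_ : (p + d + q).+4 - p.+1 - 1 = (d + q).+2)%N; last lia.
rewrite (_ : (p + d + q).+4 - (p + d).+2 - 1 = q.+1)%N; last lia.
rewrite (_ : (p + d + q).+4 - (p + d).+3 = q.+1)%N; last lia.
rewrite subn1 /= exprS.
apply: (@ratio_step _ _ _ _ d.+2%:R); try by apply: binR_neq0; lia.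
- by rewrite -!natrM mul_bin_down -2!addnS addKn.
- by rewrite -!natrM mul_bin_left -2!addSn addnK.
Qed.

Lemma beta_first n m : (0 < m)%N -> (m.+1 < n)%N ->
  (n - m.+1)%:R * beta R n m m.+1 = m%:R.
Proof.
case: m => // p _ pn; have [q qn] : exists q, n = (p + q).+3.
  by exists (n - p.+3)%N; lia.
subst n; rewrite /beta.
rewrite (_ : p.+2 - p.+1 - 1 = 0)%N; last lia.
rewrite (_ : p.+2 - 1 = p.+1)%N; last lia.
rewrite (_ : p.+1 - 1 = p)%N; last lia.
rewrite (_ : (p + q).+3 - p.+1 - 1 = q.+1)%N; last lia.
rewrite (_ : (p + q).+3 - p.+2 = q.+1)%N; last lia.
by rewrite subn1 /= !binSn expr0 mul1r mulrC divfK // pnatr_eq0.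
Qed.

Lemma telescope_paid n c x a b : (a < b)%N ->
  (forall l, (a <= l)%N -> (l.+1 < b)%N ->
    l%:R * c l = - ((n - l.+1)%:R * c l.+1)) ->
  \sum_(a <= l < b) c l * paid n x l
  = (n - a)%:R * c a * x a + b.-1%:R * c b.-1 * x b.
Proof.
move=> ab; rewrite -(subnK ab) addnC; elim: (b - a.+1)%N => [|d IHd] crec.
  by rewrite addn0 big_nat1 /paid /=; ring.
rewrite addnS big_nat_recr /=; last by rewrite addSn ltnW // ltnS leq_addr.
rewrite IHd => [|l al ld]; last by apply: crec; rewrite // addnS ltnW.
rewrite addSn /= [paid _ _ _]/paid.
have := crec (a + d)%N (leq_addr _ _); rewrite addSn addnS => /(_ (ltnSn _)) ->.
by ring.
Qed.

(** The upper end of the telescope is [m * x m.+1], as [alpha] is 1 at index [m]; it cancels the VCG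
    total and leaves the lower end. *)
Lemma alpha_budget n m k x : (m < n)%N -> (k < m)%N ->
  \sum_(k.+1 <= l < m.+1) alpha R n m l * paid n x l - m%:R * x m.+1
  = (n - k.+1)%:R * alpha R n m k.+1 * x k.+1.
Proof.
move=> mn km; rewrite telescope_paid //=; first by rewrite alphamm; ring.
by move=> l kl lm; apply: alpha_rec => //; lia.
Qed.

(** By [beta_first] the lower end of the telescope cancels the VCG total. Since [e] is chosen before
    [x], the constant sequence 1 later identifies it. *)
Lemma beta_budget n m k : (0 < m)%N -> (m < k)%N -> (k <= n)%N ->
  exists e, forall x,
    \sum_(m.+1 <= l < k) beta R n m l * paid n x l - m%:R * x m.+1 = e * x k.
Proof.
move=> m0 mk kn; have [k1|km] := leqP k m.+1.
  (* For [k = m + 1] the sum is empty and only the VCG total remains. *)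
  exists (- m%:R) => x; rewrite big_geq // sub0r mulNr.
  by rewrite (_ : k = m.+1) //; lia.
exists (k.-1%:R * beta R n m k.-1) => x.
rewrite telescope_paid //; last by move=> l ml lk; apply: beta_rec => //; lia.
by rewrite beta_first //; [ring | lia].
Qed.

Lemma sum_range_if n a b (F : nat -> R) : (0 < a)%N -> (b <= n)%N ->
  \sum_(1 <= j < n) (if (a <= j < b)%N then F j else 0) = \sum_(a <= j < b) F j.
Proof.
move=> a0 bn; rewrite (big_nat_widenl a 1) // (big_nat_widen _ b n) //.
by rewrite -big_mkcond.
Qed.

(* The constants of index k are the alternating ones on [a, b), and the weight
   at k (at 0 if k is 0 or n) is what makes the budget vanish on constants. *)
Lemma budget_pivot n m k a b (c g x : nat -> R) (c0 e v : R) :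
  (0 < n)%N -> (0 < a)%N -> (b <= n)%N -> (k <= n)%N ->
  (forall j, (0 < j < n)%N -> c j = (if (a <= j < b)%N then g j else 0)
     + (if j == k then m%:R / n%:R - \sum_(a <= i < b) g i else 0)) ->
  c0 = (if (0 < k < n)%N then 0 else v * (m%:R / n%:R - \sum_(a <= i < b) g i)) ->
  ((0 < k < n)%N -> x k = v /\ x k.+1 = v) ->
  \sum_(a <= j < b) g j * paid n x j - m%:R * x m.+1 = e * v ->
  \sum_(a <= j < b) g j * paid n (fun=> 1) j - m%:R = e ->
  n%:R * c0 + \sum_(1 <= j < n) c j * paid n x j - m%:R * x m.+1 = 0.
Proof.
move=> n0 a0 bn kn cE -> xk bx b1; set w := m%:R / n%:R - _.
have nw : n%:R * w = - e.
  rewrite -b1 mulrBr mulrCA divff ?mulr1 ?pnatr_eq0 -?lt0n // mulr_sumr opprB.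
  congr (_ - _); apply: eq_big_nat => j /andP[_ jb].
  by rewrite paid1 1?mulrC // (leq_trans (ltnW jb) bn).
have -> : \sum_(1 <= j < n) c j * paid n x j
        = \sum_(a <= j < b) g j * paid n x j
          + \sum_(1 <= j < n | j == k) w * paid n x j.
  rewrite -(sum_range_if (fun j => g j * paid n x j) a0 bn).
  rewrite [X in _ + X]big_mkcond -big_split /=; apply: eq_big_nat => j jn.
  rewrite cE // -/w mulrDl.
  by congr (_ + _); case: ifP; rewrite ?mul0r.
(* For [0 < k < n] the weight at [k] pays [w * n * v], which is [- e * v]; otherwise [k] is outside
   the summation range and [n * c0] contributes this amount. *)
rewrite big_nat1_eq; case: ifP xk => [k0n /(_ isT) [xk xk1] | kout _].
  have -> : w * paid n x k = - (e * v).
    by rewrite /paid xk xk1 -mulrDl -natrD subnK // mulrA [w * _]mulrC nw mulNr.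
  by rewrite mulr0 add0r addrAC bx subrr.
by rewrite addr0 mulrCA nw -addrA bx mulrN mulrC addNr.
Qed.

Lemma oel_budget_pivot n m k L U x v :
  (0 < m)%N -> (m < n)%N -> (k <= n)%N -> odd (k + m) ->
  ((0 < k)%N -> x k = v) -> ((k < n)%N -> x k.+1 = v) ->
  (k = 0%N -> v = U) -> (k = n -> v = L) ->
  n%:R * oel_c n m L U k 0 + \sum_(1 <= j < n) oel_c n m L U k j * paid n x j
  - m%:R * x m.+1 = 0.
Proof.
move=> m0 mn kn km xk xk1 vU vL; have n0 := ltn_trans m0 mn.
have xkk : (0 < k < n)%N -> x k = v /\ x k.+1 = v.
  by case/andP=> k0 ltkn; split; [apply: xk | apply: xk1].
(* For [k < m], including [k = 0], the constants [alpha] fill the range from [k + 1] to [m]; for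
   [k > m], including [k = n], [beta] fills that from [m + 1] to [k - 1]. Parity excludes
   [k = m]. *)
have [ltkm|lemk] := ltnP k m.
- have ltkn := ltn_trans ltkm mn.
  apply: (@budget_pivot n m k k.+1 m.+1 (oel_c n m L U k) (alpha R n m) x _
    ((n - k.+1)%:R * alpha R n m k.+1) v) => //.
  + move=> j /andP[j0 jn]; rewrite /oel_c (gtn_eqF j0) ltnS (ltnW ltkm).
    have [jk|jk] := eqVneq j k.
      by rewrite jk in j0 *; rewrite ltnn (gtn_eqF j0) add0r.
    by rewrite addr0; case: eqP => // k0; rewrite k0 j0.
  + rewrite ltkn andbT /oel_c; case: k {ltkn xkk xk xk1 vL km kn} ltkm vU => [|k] ltkm vU.
      by rewrite vU // mulrBr.
    by rewrite (ltnW ltkm).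
  + by rewrite alpha_budget // xk1.
  + by have := @alpha_budget n m k (fun=> 1) mn ltkm; rewrite !mulr1.
have {lemk} ltmk : (m < k)%N.
  by rewrite ltn_neqAle lemk andbT; apply: contraTneq km => ->; rewrite addnn odd_double.
have [e be] := beta_budget m0 ltmk kn.
have k0 : (0 < k)%N by exact: leq_ltn_trans ltmk.
apply: (@budget_pivot n m k m.+1 k (oel_c n m L U k) (beta R n m) x _ e v) => //.
- move=> j /andP[j0 jn]; rewrite /oel_c (gtn_eqF j0) (gtn_eqF k0) leqNgt ltmk /=.
  have [lekn|ltnk] := leqP k (n - 1).
    by have [->|jk] := eqVneq j k; rewrite ?ltnn ?andbF ?add0r ?addr0.
  have -> : k = n by lia.
  by rewrite (ltn_eqF jn) addr0.
- rewrite k0 /oel_c (gtn_eqF k0) leqNgt ltmk /=.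
  have [ltkn|lenk] := ltnP k n.
    by rewrite (_ : (k <= n - 1)%N = true) 1?(ltn_eqF k0) //; lia.
  have kneq : k = n by lia.
  rewrite (_ : (k <= n - 1)%N = false); last lia.
  by rewrite vL // kneq mulrBr.
- by rewrite be xk.
- by have := be (fun=> 1); rewrite !mulr1.
Qed.

(** * Total taxes of VCG and OEL at a profile *)

Context {n m : nat}.
Implicit Types (f : ('I_n -> R) -> {set 'I_n}) (theta : 'I_n -> R).

(** In the induction, the carried [p] copies of [theta]_(p+1) join [n - (p + 1)] new ones to make
    [n - 1]. *)
Lemma sum_top_others theta p : (p < n)%N ->
  \sum_i \sum_(1 <= j < p.+1) kth (others theta i) j
  = n.-1%:R * \sum_(1 <= j < p.+1) kth (profile theta) j
    + p%:R * kth (profile theta) p.+1.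
Proof.
elim: p => [|p IHp] pn.
  by rewrite big1 => [|i _]; rewrite !big_geq // mul0r mulr0 addr0.
under eq_bigr do rewrite big_nat_recr //=.
rewrite big_split /= IHp 1?ltnW // sum_kth_others ?pn //.
rewrite [in RHS]big_nat_recr //= natrB ?(ltnW pn) //.
have -> : n%:R = n.-1%:R + 1 :> R by rewrite natr1 prednK // (leq_ltn_trans _ pn).
by rewrite -[p.+1%:R]natr1; ring.
Qed.

(** Each bidder's value is counted for the [n - 1] others, which cancels the first term of
    [sum_top_others] because the winners hold the [m] highest values. *)
Lemma sum_vcg L U f theta : (m < n)%N -> efficient m L U f -> in_dom L U theta ->
  \sum_i vcg m f i theta = - (m%:R * kth (profile theta) m.+1).
Proof.
move=> mn /[apply] -[cardf topf]; rewrite /vcg sumrB sum_top_others //.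
have := sum_value_top topf; rewrite cardf => <-.
set V := \sum_i value _ _ i.
under eq_bigr => i _.
  have -> : \sum_(j < n | j != i) value theta (f theta) j = V - value theta (f theta) i.
    by rewrite /V [in RHS](bigD1 i) //= addrAC subrr add0r.
  over.
rewrite sumrB sumr_const card_ord -/V -[V *+ n]mulr_natl.
have -> : n%:R = n.-1%:R + 1 :> R by rewrite natr1 prednK // (leq_ltn_trans _ mn).
by ring.
Qed.

Lemma sum_oel L U f k theta : (m < n)%N -> efficient m L U f -> in_dom L U theta ->
  \sum_i oel m L U f k i theta
  = n%:R * oel_c n m L U k 0
    + \sum_(1 <= j < n) oel_c n m L U k j * paid n (kth (profile theta)) j
    - m%:R * kth (profile theta) m.+1.
Proof.
move=> mn ef dth; rewrite /oel 2!big_split /= (sum_vcg mn ef dth).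
rewrite sumr_const card_ord -[_ *+ n]mulr_natl exchange_big /= -addrA addrC.
congr (_ + _ - _); apply: eq_big_nat => j jn.
by rewrite -mulr_sumr sum_kth_others.
Qed.

End Budget.

Theorem theorem1 (R : realFieldType) (n m : nat) (L U : R)
    (hn : (2 <= n)%N) (hm1 : (1 <= m)%N) (hmn : (m <= n - 1)%N) (hLU : L < U)
    (f : ('I_n -> R) -> {set 'I_n}) (hf : efficient m L U f)
    (k : nat) (hk : (k <= n)%N) (hkm : odd (k + m))
    (t' : mechanism R n) (hg : groves L U f t') (hfeas : feasible L U t') :
  ~ welfare_dominates L U t' (oel m L U f k).
Proof.
case: hg => h [hloc ht'] [dom [theta [dth lt_theta]]].
have ltmn : (m < n)%N by lia.
(* This is the tax under [t'] minus the OEL tax. The values of the other bidders under [f] cancel,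
   so [g i] ignores the entry of bidder [i]. *)
pose g i th := h i th + \sum_(1 <= j < m.+1) kth (others th i) j
  - (oel_c n m L U k 0 + \sum_(1 <= j < n) oel_c n m L U k j * kth (others th i) j).
have gE th : in_dom L U th -> \sum_i g i th = \sum_i t' i th - \sum_i oel m L U f k i th.
  move=> dh; rewrite -sumrB; apply: eq_bigr => i _.
  by rewrite ht' // /oel /vcg /g; ring.
have others_local (th th' : 'I_n -> R) i : (forall j, j != i -> th j = th' j) ->
    others th i = others th' i.
  by move=> eqth; apply/eq_in_map => j; rewrite mem_filter => /andP[/eqth].
suff : \sum_i g i theta = 0.
  by rewrite gE // => /eqP; rewrite subr_eq0 => /eqP eqt; rewrite eqt ltxx in lt_theta.
apply: (@pivot_sum_eq0 R n L U k g _ hk _ _ _ _ theta dth); first lia.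
- move=> i th th' dh dh' eqth.
  by rewrite /g (hloc i th th') // (others_local th th').
- by move=> th dh; rewrite gE // subr_ge0 dom.
- move=> th v dh pv; rewrite gE // (sum_oel _ ltmn hf dh).
  have [xk xk1] := pivot_kth pv hk; case: pv => _ _ vU vL.
  (* The OEL budget is balanced at a pivotal profile, so feasibility of [t'] bounds the difference
     by 0. *)
  by rewrite (oel_budget_pivot hm1 ltmn hk hkm xk xk1 vU vL) subr0 hfeas.
- by move=> th a dh; apply: upd_pivot.
Qed.
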